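(* Let $n,K,d_1,d_2$ be positive integers. Set $d=\max(d_1,d_2)$. There exist two absolute positive constants $c,c'$ such that $$\inf_{\widetilde P}\ \sup_{P\in\mathcal{T}_K}\ \mathbb{P}_P\Big(\|\widetilde P-P\|_1\ \ge\ c\,\min\big\{\sqrt{Kd/n},\,1\big\}\Big)\ \ge\ c'$$ and $$\inf_{\widetilde P}\ \sup_{P\in\mathcal{T}_K}\ \mathbb{E}_P\|\widetilde P-P\|_1\ \ge\ c\,\min\big\{\sqrt{Kd/n},\,1\big\}.$$
   Context: $\mathcal{T}_K$ is the set of all matrices $P\in\mathbb{R}^{d_1\times d_2}$ with rank at most $K$, nonnegative entries, and $\sum_{i,j}P_{ij}=1$. Observations $X_1,\dots,X_n$ are iid with $\mathbb{P}_P(X_k=(i,j))=P_{ij}$ for $(i,j)\in\{1,\dots,d_1\}\times\{1,\dots,d_2\}$; $\mathbb{P}_P$ and $\mathbb{E}_P$ denote the corresponding probability measure and expectation. $\inf_{\widetilde P}$ is the infimum over all $\mathbb{R}^{d_1\times d_2}$-valued estimators (measurable functions of $X_1,\dots,X_n$). $\|\cdot\|_1$ is the entrywise $\ell_1$ norm.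
   Formalization: The formal statement adds K ≤ min(d_1,d_2) and max(d_1,d_2) ≥ 2; without them the claim fails (d_1=1, d_2=2, K=n→∞: the rate is 1 but empirical frequencies have risk → 0; d_1=d_2=1: the constant estimator 1 has zero error). *)

(* Defs.v *)
(* MathComp / MathComp-Analysis *)
From HB Require Import structures.
From mathcomp Require Import all_boot all_order all_algebra.
From mathcomp Require Import all_classical all_reals all_analysis.

Set Implicit Arguments.
Unset Strict Implicit.
Unset Printing Implicit Defensive.

Import Order.TTheory GRing.Theory Num.Theory.

Local Open Scope classical_set_scope.
Local Open Scope ring_scope.

Definition low_rank_pmf (R : realType) (d1 d2 K : nat) : set 'M[R]_(d1, d2) :=
  [set P | [/\ (\rank P <= K)%N,
               forall i j, 0 <= P i j
             & \sum_(i < d1) \sum_(j < d2) P i j = 1]].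

Definition l1norm (R : realType) (d1 d2 : nat) (A : 'M[R]_(d1, d2)) : R :=
  \sum_(i < d1) \sum_(j < d2) `|A i j|.

(* The set of cells carries the discrete sigma-algebra. It is not declared as a
   [measurableType], which would require it to be pointed. *)
Definition discrete_rv (d : measure_display) (Omega : measurableType d)
    (T : finType) (X : Omega -> T) : Prop :=
  forall B : set T, measurable (X @^-1` B).

Definition mutually_independent (R : realType) (d : measure_display)
    (Omega : measurableType d) (Pr : probability Omega R) (n : nat)
    (T : finType) (X : 'I_n -> Omega -> T) : Prop :=
  forall (J : {set 'I_n}) (B : 'I_n -> set T),
    Pr (\bigcap_(k in [set` J]) (X k @^-1` B k))
      = (\prod_(k in J) Pr (X k @^-1` B k))%E.

Definition iid_sample (R : realType) (d : measure_display)
    (Omega : measurableType d) (Pr : probability Omega R) (n d1 d2 : nat)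
    (X : 'I_n -> Omega -> 'I_d1 * 'I_d2) (P : 'M[R]_(d1, d2)) : Prop :=
  [/\ forall k, discrete_rv (X k),
      forall k i j, Pr (X k @^-1` [set (i, j)]) = (P i j)%:E
    & mutually_independent Pr X].

Definition sample (n d1 d2 : nat) : Type := {ffun 'I_n -> 'I_d1 * 'I_d2}.

Definition observed (Omega : Type) (n d1 d2 : nat)
    (X : 'I_n -> Omega -> 'I_d1 * 'I_d2) (w : Omega) : sample n d1 d2 :=
  [ffun k => X k w].

(* The sample space is finite and discrete, so every function on it is
   measurable: estimators are all matrix-valued functions of the sample. *)
Definition estimator (R : realType) (n d1 d2 : nat) : Type :=
  sample n d1 d2 -> 'M[R]_(d1, d2).

Definition minimax (R : realType) (n d1 d2 : nat) (Theta : set 'M[R]_(d1, d2))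
    (risk : estimator R n d1 d2 -> 'M[R]_(d1, d2) -> \bar R) : \bar R :=
  ereal_inf [set ereal_sup [set risk Pt P | P in Theta]
            | Pt in [set: estimator R n d1 d2]].

Definition rate (R : realType) (n K d1 d2 : nat) : R :=
  Num.min (Num.sqrt ((K * maxn d1 d2)%:R / n%:R)) 1.

(* Main.v *)
Require Import Defs.
From HB Require Import structures.
From mathcomp Require Import all_boot all_order all_algebra.
From mathcomp Require Import all_classical all_reals all_analysis.
From mathcomp Require Import measurable_realfun ring lra zify.

Set Implicit Arguments.
Unset Strict Implicit.
Unset Printing Implicit Defensive.

Import Order.TTheory GRing.Theory Num.Theory.

Local Open Scope classical_set_scope.
Local Open Scope ring_scope.

(** A lower bound over the whole class follows from one over a finite subfamily
indexed by sign patterns, by Assouad's method.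

Say that d2 <= d1 = d. Matrices supported in K fixed columns have rank at most
K. With d / 2 rounded down, take m = (d / 2) K disjoint vertical pairs of
entries of these columns, and let the two entries of the pair u be
(1 + delta) / 2m and (1 - delta) / 2m, in the order prescribed by one bit s u.
Each such matrix sums to 1, whatever s is; two of them are at l1 distance
2 delta / m times the number of bits on which their patterns differ.

Flipping one bit changes the law of a single observation by a squared Hellinger
distance of order delta^2 / m, so the law of n observations cannot detect it as
long as n delta^2 / m is small: the two product laws keep an overlap of 1/4
([overlap_prod_mass], [overlap_perturbed]). Hence, for uniformly random s, any
decoder errs on each bit with probability at least 1/8, so on an average of at
least m / 8 bits ([assouad_mean_hamming]). The number of errors never exceeds m;
by a reverse Markov inequality some s forces m / 16 errors with probability at
least 1/16 ([assouad_in_probability]). An estimator of the matrix gives a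
decoder by thresholding one entry of each pair, and each wrong bit costs it
delta / 2m in l1 norm; so its loss is at least delta / 32 with probability at
least 1/16 ([paired_perturbation_bound]).

Since d >= 2 gives K d <= 3 m, the choice delta = rate / 4 satisfies
n delta^2 / m <= 1/4, which gives the bound in probability. Markov's inequality
turns it into the bound in expectation. *)

(** * Assouad's method *)

Section Assouad.
Variables (R : realFieldType) (U X : finType).
Implicit Types (s : {ffun U -> bool}) (u : U).

Definition flip u s : {ffun U -> bool} := [ffun v => (v == u) (+) s v].

Lemma flipK u : involutive (flip u).
Proof. by move=> s; apply/ffunP => v; rewrite !ffunE addKb. Qed.

Definition hamming s t : nat := #|[pred u | s u != t u]|.

Lemma hammingE s t : (hamming s t)%:R = \sum_u (s u != t u)%:R :> R.
Proof.
rewrite /hamming -sum1_card natr_sum big_mkcond /=; apply: eq_bigr => u _.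
by rewrite inE; case: ifP.
Qed.

(** Pair each pattern with its flip at u: exactly one of the two makes a given
decoded bit wrong, so the two error probabilities add up to at least the overlap
of the two laws. *)
Lemma assouad_mean_hamming (P : {ffun U -> bool} -> X -> R) (alpha : R)
    (dec : X -> {ffun U -> bool}) :
  (forall s x, 0 <= P s x) ->
  (forall s u, alpha <= \sum_x Num.min (P s x) (P (flip u s) x)) ->
  (2 ^ #|U|)%:R * (#|U|%:R * (alpha / 2)) <=
    \sum_s \sum_x P s x * (hamming (dec x) s)%:R.
Proof.
move=> P0 hov.
have per_coordinate u : (2 ^ #|U|)%:R * (alpha / 2) <=
    \sum_s \sum_x P s x * (dec x u != s u)%:R.
  set S := \sum_s _.
  have SE : S = \sum_s \sum_x P (flip u s) x * (dec x u != flip u s u)%:R.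
    by rewrite /S (reindex_inj (can_inj (flipK u))).
  suff : (2 ^ #|U|)%:R * alpha <= S + S by lra.
  rewrite {2}SE -big_split /=.
  have -> : (2 ^ #|U|)%:R * alpha = \sum_(s : {ffun U -> bool}) alpha.
    by rewrite sumr_const card_ffun card_bool mulr_natl.
  apply: ler_sum => s _; apply: le_trans (hov s u) _.
  rewrite -big_split; apply: ler_sum => x _ /=.
  rewrite ffunE eqxx /=.
  have := P0 s x; have := P0 (flip u s) x.
  case: (dec x u) (s u) => [] [] /=;
    rewrite !(mulr1, mulr0) ?add0r ?addr0 => _ _; by rewrite ge_min lexx ?orbT.
have -> : \sum_s \sum_x P s x * (hamming (dec x) s)%:R =
    \sum_u \sum_s \sum_x P s x * (dec x u != s u)%:R.
  rewrite [RHS]exchange_big /=; apply: eq_bigr => s _.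
  rewrite [RHS]exchange_big /=; apply: eq_bigr => x _.
  by rewrite hammingE mulr_sumr.
rewrite mulrCA mulr_natl -sumr_const; exact: ler_sum.
Qed.

(** The fraction of wrong bits lies in [0, 1], so if it reached alpha / 4 with
probability less than alpha / 4 under every pattern, then its mean would be less
than alpha / 2 under every pattern, against [assouad_mean_hamming]. *)
Lemma assouad_in_probability (P : {ffun U -> bool} -> X -> R) (alpha : R)
    (dec : X -> {ffun U -> bool}) :
  (0 < #|U|)%N ->
  (forall s x, 0 <= P s x) -> (forall s, \sum_x P s x = 1) ->
  (forall s u, alpha <= \sum_x Num.min (P s x) (P (flip u s) x)) ->
  exists s, alpha / 4 <=
    \sum_(x | alpha / 4 * #|U|%:R <= (hamming (dec x) s)%:R) P s x.
Proof.
move=> U0 P0 P1 hov; apply/existsP; apply: contraT => /existsPn small.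
have m0 : 0 < #|U|%:R :> R by rewrite ltr0n.
have markov s : \sum_x P s x * (hamming (dec x) s)%:R <
    #|U|%:R * (alpha / 2).
  set beta := alpha / 4.
  set E := \sum_(x | beta * #|U|%:R <= (hamming (dec x) s)%:R) P s x.
  have EltB : E < beta by rewrite ltNge; exact: small.
  suff : \sum_x P s x * (hamming (dec x) s)%:R <= #|U|%:R * (beta + E).
    move=> /le_lt_trans; apply; rewrite ltr_pM2l //; rewrite /beta in EltB *; lra.
  have -> : beta = \sum_x beta * P s x by rewrite -mulr_sumr P1 mulr1.
  rewrite /E [X in _ * (_ + X)]big_mkcond -big_split mulr_sumr /=.
  apply: ler_sum => x _; have Psx := P0 s x.
  have ham_le : (hamming (dec x) s)%:R <= #|U|%:R :> R.
    by rewrite ler_nat max_card.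
  case: ifPn => [big|]; last by rewrite -ltNge => /ltW le_b; nra.
  have beta0 : 0 <= beta.
    apply: ltW; apply: le_lt_trans EltB.
    by apply: sumr_ge0 => y _; exact: P0.
  have : 0 <= #|U|%:R * beta * P s x by apply: mulr_ge0 => //; exact: mulr_ge0.
  by nra.
have := assouad_mean_hamming dec P0 hov; rewrite leNgt => /negP[].
have -> : (2 ^ #|U|)%:R * (#|U|%:R * (alpha / 2)) =
    \sum_(s : {ffun U -> bool}) #|U|%:R * (alpha / 2).
  by rewrite sumr_const card_ffun card_bool mulr_natl.
apply: ltr_sum => //; apply/hasP.
by exists [ffun=> true]; rewrite ?mem_index_enum.
Qed.
End Assouad.

(** * Overlap of product laws *)

Section ProductOverlap.
Variables (R : realFieldType) (T : finType) (n : nat).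

Definition prod_mass (p : T -> R) (x : {ffun 'I_n -> T}) : R := \prod_k p (x k).

Lemma prod_mass_ge0 p x : (forall t, 0 <= p t) -> 0 <= prod_mass p x.
Proof. by move=> p0; apply: prodr_ge0. Qed.

Lemma sum_prod_mass p : \sum_x prod_mass p x = (\sum_t p t) ^+ n.
Proof. by rewrite -(bigA_distr_bigA (fun=> p)) prodr_const card_ord. Qed.

Lemma bernoulli (e : R) : 0 <= e <= 1 -> 1 - n%:R * e <= (1 - e) ^+ n.
Proof.
move=> e01; elim: n => [|k IHk]; first by rewrite mul0r subr0 expr0.
rewrite exprS -natr1.
have : (1 - e) * (1 - k%:R * e) <= (1 - e) * (1 - e) ^+ k.
  by apply: ler_wpM2l; lra.
have : 0 <= k%:R * e * e by rewrite !mulr_ge0 //; lra.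
lra.
Qed.

(** The function g is a minorant of the Hellinger density sqrt(p q); choosing it
easy to sum spares the square root. Its mass tensorizes, while the overlap does
not. The passage to the overlap is therefore made on the product laws, by the
AM-GM inequality sqrt(a b) <= a + b / 4. *)
Lemma overlap_prod_mass (p q g : T -> R) (e : R) :
  (forall t, 0 <= p t) -> (forall t, 0 <= q t) -> (forall t, 0 <= g t) ->
  (forall t, g t ^+ 2 <= p t * q t) ->
  \sum_t p t = 1 -> \sum_t q t = 1 -> \sum_t g t = 1 - e ->
  0 <= e <= 1 -> n%:R * e <= 1 / 4 ->
  1 / 4 <= \sum_x Num.min (prod_mass p x) (prod_mass q x).
Proof.
move=> p0 q0 g0 gpq p1 q1 g1 e01 ne.
have affinity : 3 / 4 <= \sum_x prod_mass g x.
  by rewrite sum_prod_mass g1; have := bernoulli e01; lra.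
have {}gpq x : prod_mass g x ^+ 2 <= prod_mass p x * prod_mass q x.
  rewrite /prod_mass -big_split -prodrXl; apply: ler_prod => k _.
  by rewrite sqr_ge0 gpq.
have pointwise x : prod_mass g x <= Num.min (prod_mass p x) (prod_mass q x) +
    (prod_mass p x + prod_mass q x) / 4.
  have := gpq x; have := prod_mass_ge0 x p0; have := prod_mass_ge0 x q0.
  have := prod_mass_ge0 x g0.
  move: (prod_mass g x) (prod_mass p x) (prod_mass q x) => c a b c0 b0 a0 cab.
  have amgm (y z : R) : 0 <= y -> 0 <= z -> c ^+ 2 <= y * z ->
      c <= y + (y + z) / 4.
    move=> y0 z0 cyz; rewrite -(ler_pXn2r (n := 2)) ?nnegrE //; last lra.
    have := sqr_ge0 (y - z / 4); rewrite !expr2 in cyz *; nra.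
  rewrite minElt; case: ifP => _; first exact: amgm.
  by rewrite (addrC a); apply: amgm; rewrite // mulrC.
have : \sum_x prod_mass g x <= \sum_x (Num.min (prod_mass p x) (prod_mass q x) +
    (prod_mass p x + prod_mass q x) / 4) by exact: ler_sum.
rewrite big_split /= -mulr_suml big_split /= !sum_prod_mass p1 q1 !expr1n.
rewrite sum_prod_mass in affinity *; lra.
Qed.
End ProductOverlap.

(** * Perturbation of paired cells *)

Section PairedPerturbation.
Variables (R : realFieldType) (U T : finType) (cell : U * bool -> T).
Hypothesis cell_inj : injective cell.

(** Image under [cell] of the measure with masses w. *)
Definition push (w : U * bool -> R) (t : T) : R := \sum_(v | cell v == t) w v.

Lemma push_cell w v : push w (cell v) = w v.
Proof.
by rewrite /push (eq_bigl (pred1 v)) ?big_pred1_eq // => v'; rewrite inj_eq.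
Qed.

Variant push_spec t : Type :=
| PushCell v of t = cell v
| PushOutside of (forall w, push w t = 0).

Lemma pushP t : push_spec t.
Proof.
case: (pickP (fun v => cell v == t)) => [v /eqP <-|out]; first exact: PushCell.
by apply: PushOutside => w; rewrite /push big_pred0.
Qed.

Lemma push_ge0 w t : (forall v, 0 <= w v) -> 0 <= push w t.
Proof. by move=> w0; apply: sumr_ge0. Qed.

Lemma sum_push w : \sum_t push w t = \sum_v w v.
Proof. by rewrite [RHS](partition_big cell xpredT). Qed.

Lemma sum_cells_le (f : T -> R) : (forall t, 0 <= f t) ->
  \sum_v f (cell v) <= \sum_t f t.
Proof.
move=> f0; rewrite -sum_push; apply: ler_sum => t _.
by case: (pushP t) => [v ->|->//]; rewrite push_cell.
Qed.

Lemma sum_pair_bool (f : U * bool -> R) :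
  \sum_v f v = \sum_u (f (u, true) + f (u, false)).
Proof.
rewrite (eq_bigr (fun v => f (v.1, v.2))) => [|[]//].
rewrite -(pair_bigA _ (fun u b => f (u, b))) /=.
by apply: eq_bigr => u _; rewrite big_bool.
Qed.

Hypothesis U_gt0 : (0 < #|U|)%N.
Let m : R := #|U|%:R.

Let m_gt0 : 0 < m. Proof. by rewrite ltr0n. Qed.

Variable delta : R.
Hypotheses (delta_ge0 : 0 <= delta) (delta_le1 : delta <= 1).

(** For delta > 0, the heavier cell of the pair u is (u, s u). *)
Definition weight (s : {ffun U -> bool}) (v : U * bool) : R :=
  (1 + delta * (-1) ^+ (v.2 (+) s v.1)) / (2 * m).

Lemma weight_ge0 s v : 0 <= weight s v.
Proof.
have d0 := delta_ge0; have d1 := delta_le1.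
apply: divr_ge0; last by rewrite mulr_ge0 // ltW.
by case: (_ (+) _); rewrite /= ?expr1 ?expr0; lra.
Qed.

Lemma sum_weight s : \sum_v weight s v = 1.
Proof.
rewrite sum_pair_bool (eq_bigr (fun=> m^-1)) => [|u _].
  by rewrite sumr_const -mulr_natl divff // gt_eqF.
rewrite /weight /= -mulrDl addrACA -mulrDr.
have -> : (-1) ^+ (~~ s u) + (-1) ^+ s u = 0 :> R.
  by case: (s u); rewrite /= !(expr0, expr1); lra.
by rewrite mulr0 addr0; field; rewrite gt_eqF.
Qed.

Definition perturbed (s : {ffun U -> bool}) : T -> R := push (weight s).

Lemma perturbed_ge0 s t : 0 <= perturbed s t.
Proof. by apply: push_ge0 => v; exact: weight_ge0. Qed.

Lemma sum_perturbed s : \sum_t perturbed s t = 1.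
Proof. by rewrite sum_push sum_weight. Qed.

(** The laws for s and its flip at u agree off the pair u. There the product of
the two masses is (1 - delta^2) / (2m)^2, at least the square of
(1 - delta^2) / 2m; with this mass on both cells of the pair, the minorant of
the Hellinger density sums to 1 - delta^2 / m. *)
Lemma overlap_perturbed n s u : n%:R * (delta ^+ 2 / m) <= 1 / 4 ->
  1 / 4 <= \sum_(x : {ffun 'I_n -> T}) Num.min
    (prod_mass (perturbed s) x) (prod_mass (perturbed (flip u s)) x).
Proof.
move=> ndelta; have d0 := delta_ge0; have d1 := delta_le1.
have delta2 : 0 <= delta ^+ 2 <= 1.
  by rewrite sqr_ge0 expr2 mulr_ile1 //; lra.
pose g (v : U * bool) :=
  if v.1 == u then (1 - delta ^+ 2) / (2 * m) else weight s v.
have g0 v : 0 <= g v.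
  rewrite /g; case: ifP => _; last exact: weight_ge0.
  by rewrite divr_ge0 ?mulr_ge0 ?(ltW m_gt0) // ?subr_ge0; lra.
apply: (@overlap_prod_mass _ _ _ _ _ (push g) (delta ^+ 2 / m)) => //.
- exact: perturbed_ge0.
- exact: perturbed_ge0.
- by move=> t; exact: push_ge0.
- move=> t; rewrite /perturbed; case: (pushP t) => [v ->|out]; last first.
    by rewrite !out mulr0 expr0n.
  rewrite !push_cell /g /weight ffunE; case: eqP => [->|_] /=; last first.
    by rewrite expr2.
  rewrite expr_div_n mulf_div -expr2.
  rewrite ler_pM2r ?invr_gt0 ?exprn_gt0 ?mulr_gt0 //.
  have : 0 <= delta ^+ 2 * (1 - delta ^+ 2) by rewrite mulr_ge0 //; lra.
  by case: v.2 (s u) => [] [] /=; rewrite ?eqxx ?expr0 ?expr1 !expr2 => ?; lra.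
- exact: sum_perturbed.
- exact: sum_perturbed.
- rewrite sum_push -(sum_weight s) !sum_pair_bool.
  rewrite (bigD1 u) //= [X in _ = X - _](bigD1 u) //=.
  rewrite [RHS]addrAC; congr (_ + _); last first.
    by apply: eq_bigr => u' /negbTE u'u; rewrite /g /= u'u.
  rewrite /g /weight /= !eqxx.
  case: (s u) => /=; rewrite !(expr0, expr1); (field; by rewrite gt_eqF).
- apply/andP; split; first by rewrite divr_ge0 ?(ltW m_gt0) ?sqr_ge0.
  rewrite ler_pdivrMr // mul1r.
  by apply: le_trans (_ : 1 <= _); rewrite ?ler1n //; lra.
Qed.

Definition sign_decoder (q : T -> R) : {ffun U -> bool} :=
  [ffun u => q (cell (u, false)) < (2 * m)^-1].

(** The threshold 1 / 2m is the midpoint of the two possible masses of the cell,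
which are delta / 2m away from it. *)
Lemma hamming_le_l1 (q : T -> R) (s : {ffun U -> bool}) :
  delta / (2 * m) * (hamming (sign_decoder q) s)%:R <=
    \sum_t `|q t - perturbed s t|.
Proof.
have d0 := delta_ge0.
apply: le_trans (sum_cells_le (f := fun t => `|q t - perturbed s t|) _) => //.
rewrite sum_pair_bool hammingE mulr_sumr; apply: ler_sum => u _.
rewrite -[leLHS]add0r; apply: lerD => //.
rewrite ffunE /perturbed push_cell /weight /=.
move: (q _) => a; rewrite mulrDl mul1r.
have : 0 <= delta / (2 * m) by rewrite divr_ge0 ?mulr_ge0 ?(ltW m_gt0).
case: ltP; case: (s u) => /= ha; rewrite ?(mulr0, mulr1, expr0, expr1) //.
  by rewrite ler_normr; lra.
by rewrite ler_normr; lra.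
Qed.

(** The overlap is 1/4, so with probability at least 1/16 there are m / 16 wrong
bits, and each of them costs delta / 2m. *)
Lemma paired_perturbation_bound n (est : {ffun 'I_n -> T} -> T -> R) :
  n%:R * (delta ^+ 2 / m) <= 1 / 4 ->
  exists s, 1 / 16 <=
    \sum_(x | delta / 32 <= \sum_t `|est x t - perturbed s t|)
      prod_mass (perturbed s) x.
Proof.
move=> ndelta; have d0 := delta_ge0; have d1 := delta_le1.
have P0 s x : 0 <= prod_mass (n := n) (perturbed s) x.
  exact: prod_mass_ge0 (perturbed_ge0 s).
have P1 s : \sum_(x : {ffun 'I_n -> T}) prod_mass (perturbed s) x = 1.
  by rewrite sum_prod_mass sum_perturbed expr1n.
have [s hs] := assouad_in_probability (fun x => sign_decoder (est x)) U_gt0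
  P0 P1 (fun s u => overlap_perturbed s u ndelta).
exists s; have -> : 1 / 16 = 1 / 4 / 4 :> R by lra.
apply: le_trans hs _.
rewrite big_mkcond [leRHS]big_mkcond /=; apply: ler_sum => x _.
case: ifPn => [far|_]; last by case: ifP.
rewrite ifT //; apply: le_trans (hamming_le_l1 (est x) s).
have -> : delta / 32 = delta / (2 * m) * (1 / 4 / 4 * m).
  by field; rewrite gt_eqF.
by rewrite ler_wpM2l // divr_ge0 ?mulr_ge0 ?(ltW m_gt0) //; lra.
Qed.
End PairedPerturbation.

(** * Pairs of cells carrying low-rank matrices *)

Section LowRankCells.

Lemma mxrank_column_support (F : fieldType) d1 d2 K (A : 'M[F]_(d1, d2)) :
  (K <= d2)%N -> (forall i (j : 'I_d2), (K <= j)%N -> A i j = 0) ->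
  (\rank A <= K)%N.
Proof.
move=> Kd A0.
have -> : A = A *m pid_mx K.
  apply/matrixP => i j; rewrite mxE (bigD1 j) //= big1 => [|k kj].
    rewrite mxE eqxx addr0; case: ltnP => [|/A0 ->] /=; last by rewrite mul0r.
    by rewrite mulr1.
  by rewrite mxE (inj_eq val_inj) (negbTE kj) mulr0.
apply: leq_trans (mxrankM_maxr _ _) _.
apply: (@leq_trans (\rank (pid_mx K : 'M[F]_(d2, K)))); last exact: rank_leq_col.
by rewrite !rank_pid_mx.
Qed.

Lemma half_index_subproof d (h : 'I_(d./2)) (b : bool) : (h.*2 + b < d)%N.
Proof. by have := ltn_ord h; have := odd_double_half d; case: b; lia. Qed.

Definition half_index d (h : 'I_(d./2)) (b : bool) : 'I_d :=
  Ordinal (half_index_subproof h b).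

Lemma half_index_inj d h1 b1 h2 b2 :
  half_index h1 b1 = half_index h2 b2 :> 'I_d -> h1 = h2 /\ b1 = b2.
Proof.
move=> /(congr1 val) /= eq12; split.
  by apply/val_inj; move: eq12; case: b1; case: b2 => /=; lia.
by move: eq12; case: b1; case: b2 => //=; lia.
Qed.

(** The pairs run along the longer side of the matrix, inside K lines parallel
to it. If the longer side is odd its last index is left out. *)
Lemma low_rank_cells (F : realFieldType) K d1 d2 : (K <= minn d1 d2)%N ->
  exists2 cell : 'I_((maxn d1 d2)./2) * 'I_K * bool -> 'I_d1 * 'I_d2,
    injective cell &
    forall w : _ -> F, (\rank (\matrix_(i, j) push cell w (i, j)) <= K)%N.
Proof.
rewrite leq_min => /andP[Kd1 Kd2]; case: leqP => _.
- exists (fun v => (widen_ord Kd1 v.1.2, half_index v.1.1 v.2)).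
    move=> [[h1 k1] b1] [[h2 k2] b2] /= [k12 h12].
    have [-> ->] : h1 = h2 /\ b1 = b2 by apply: half_index_inj; apply: val_inj.
    by congr (_, _, _); apply: val_inj.
  move=> w; rewrite -mxrank_tr; apply: mxrank_column_support => // j i Ki.
  rewrite !mxE /push big_pred0 // => v; apply: contraTF Ki => /eqP[<- _] /=.
  by rewrite -ltnNge.
- exists (fun v => (half_index v.1.1 v.2, widen_ord Kd2 v.1.2)).
    move=> [[h1 k1] b1] [[h2 k2] b2] /= [h12 k12].
    have [-> ->] : h1 = h2 /\ b1 = b2 by apply: half_index_inj; apply: val_inj.
    by congr (_, _, _); apply: val_inj.
  move=> w; apply: mxrank_column_support => // i j Kj.
  rewrite mxE /push big_pred0 // => v; apply: contraTF Kj => /eqP[_ <-] /=.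
  by rewrite -ltnNge.
Qed.

End LowRankCells.

(** * Law of the observed sample *)

Section ObservedSample.
Variables (R : realType) (dOmega : measure_display).
Variables (Omega : measurableType dOmega) (Pr : probability Omega R).
Variables (n d1 d2 : nat) (X : 'I_n -> Omega -> 'I_d1 * 'I_d2).
Variable P : 'M[R]_(d1, d2).
Hypothesis iid : iid_sample Pr X P.

Let entry (t : 'I_d1 * 'I_d2) : R := P t.1 t.2.

Lemma observed_fiberE x :
  observed X @^-1` [set x] =
    \bigcap_(k in [set` [set: 'I_n]%SET]) (X k @^-1` [set x k]).
Proof.
apply/seteqP; split => w /= => [<- k _|Xx]; first by rewrite ffunE.
by apply/ffunP => k; rewrite ffunE; apply: Xx; rewrite /= inE.
Qed.

Lemma measurable_observed_fiber x : measurable (observed X @^-1` [set x]).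
Proof.
rewrite observed_fiberE; apply: fin_bigcap_measurable => [|k _].
  exact: finite_finset.
by have [mX _ _] := iid; exact: mX.
Qed.

Lemma prob_observed_fiber x :
  Pr (observed X @^-1` [set x]) = (prod_mass entry x)%:E.
Proof.
have [_ law indep] := iid.
rewrite observed_fiberE indep -prodEFin.
rewrite (eq_bigl xpredT) => [|k]; last by rewrite inE.
by apply: eq_bigr => k _; rewrite /entry -(law k) -surjective_pairing.
Qed.

Lemma measurable_observed (A : set (sample n d1 d2)) :
  measurable (observed X @^-1` A).
Proof.
have -> : observed X @^-1` A = \bigcup_(x in A) (observed X @^-1` [set x]).
  by apply/seteqP; split => w /= => [Aw|[x Ax /= ->] //]; exists (observed X w).
apply: fin_bigcup_measurable => [|x _]; first exact: finite_finset.
exact: measurable_observed_fiber.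
Qed.

Lemma prob_observed (A : pred (sample n d1 d2)) :
  Pr [set w | A (observed X w)] = (\sum_(x | A x) prod_mass entry x)%:E.
Proof.
have -> : [set w | A (observed X w)] =
    \bigcup_(x in [set` enum A]) (observed X @^-1` [set x]).
  apply/seteqP; split => w /= => [Aw|[x /=]].
    by exists (observed X w) => //=; rewrite mem_enum.
  by rewrite mem_enum => Ax ->.
rewrite measure_fin_bigcup; last first.
- by move=> x _; exact: measurable_observed_fiber.
- by move=> x y _ _ [w [/= <- <-]].
- exact: finite_finset.
rewrite -fsbig_seq ?enum_uniq // -sumEFin big_enum_cond /=.
by apply: eq_big => [x|x _]; [rewrite andbT | exact: prob_observed_fiber].
Qed.

Lemma markov_observed (loss : sample n d1 d2 -> R) (a : R) :
  (forall x, 0 <= loss x) -> 0 < a ->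
  (a%:E * Pr [set w | (a <= loss (observed X w))%R]
     <= 'E_Pr[fun w => loss (observed X w)])%E.
Proof.
move=> loss0 a0; rewrite unlock.
have mloss : measurable_fun [set: Omega] (fun w => (loss (observed X w))%:E).
  move=> _ Y mY; rewrite setTI.
  exact: (measurable_observed ((fun x => (loss x)%:E) @^-1` Y)).
have := le_integral_abse Pr measurableT mloss a0; rewrite setTI.
have -> : (fun w => `|(loss (observed X w))%:E|%E) =
    (fun w => (loss (observed X w))%:E).
  by apply/funext => w; rewrite gee0_abs ?lee_fin.
have -> // : [set w | (a%:E <= `|(loss (observed X w))%:E|)%E] =
    [set w | a <= loss (observed X w)].
by apply/seteqP; split => w /=; rewrite ger0_norm ?lee_fin.
Qed.
End ObservedSample.

(** * The minimax lower bound *)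

Lemma le_minimax (R : realType) n d1 d2 (Theta : set 'M[R]_(d1, d2)) risk b :
  (forall Pt : estimator R n d1 d2, exists2 P, Theta P & (b <= risk Pt P)%E) ->
  (b <= minimax Theta risk)%E.
Proof.
move=> hard; apply: le_ereal_inf_tmp => _ [Pt _ <-].
have [P ThetaP bP] := hard Pt; apply: le_trans bP _.
by apply: ereal_sup_ubound; exists P.
Qed.

Lemma rate_gt0 (R : realType) n K d1 d2 :
  (0 < n)%N -> (0 < K)%N -> (1 < maxn d1 d2)%N -> 0 < rate R n K d1 d2.
Proof.
move=> n0 K0 d0; rewrite /rate lt_min ltr01 andbT sqrtr_gt0.
by rewrite divr_gt0 ?ltr0n // muln_gt0 K0 ltnW.
Qed.

(** The overlap condition allows delta up to half of sqrt(m / n), and the masses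
remain nonnegative for delta up to 1; as m is at least K d / 3, a quarter of the
rate meets both requirements. *)
Lemma low_rank_hard_pmf (R : realType) n K d1 d2 (Pt : estimator R n d1 d2) :
  (0 < n)%N -> (0 < K)%N -> (K <= minn d1 d2)%N -> (1 < maxn d1 d2)%N ->
  exists2 P, low_rank_pmf K P &
    1 / 16 <= \sum_(x | 1 / 128 * rate R n K d1 d2 <= l1norm (Pt x - P))
                prod_mass (fun t => P t.1 t.2) x.
Proof.
move=> n0 K0 Kd d0.
have [cell cell_inj rank_le] := low_rank_cells R Kd.
set d := maxn d1 d2 in d0 cell cell_inj rank_le *.
set delta := rate R n K d1 d2 / 4.
have r0 := @rate_gt0 R n K d1 d2 n0 K0 d0.
have r1 : rate R n K d1 d2 <= 1 by rewrite /rate ge_min lexx orbT.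
have delta0 : 0 <= delta by rewrite /delta; lra.
have delta1 : delta <= 1 by rewrite /delta; lra.
have card_U : #|{: 'I_(d./2) * 'I_K}| = (d./2 * K)%N.
  by rewrite card_prod !card_ord.
have U0 : (0 < #|{: 'I_(d./2) * 'I_K}|)%N.
  by rewrite card_U muln_gt0 half_gt0 d0.
have ndelta : n%:R * (delta ^+ 2 / #|{: 'I_(d./2) * 'I_K}|%:R) <= 1 / 4.
  have rate2 : rate R n K d1 d2 ^+ 2 <= (K * d)%:R / n%:R.
    rewrite -[leRHS]sqr_sqrtr ?divr_ge0 //.
    by rewrite lerXn2r ?nnegrE ?sqrtr_ge0 ?(ltW r0) // /rate ge_min lexx.
  have m0 : 0 < #|{: 'I_(d./2) * 'I_K}|%:R :> R by rewrite ltr0n.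
  have n0R : 0 < n%:R :> R by rewrite ltr0n.
  rewrite mulrA ler_pdivrMr // /delta expr_div_n.
  have Kdm : (K * d)%:R <= 3 * #|{: 'I_(d./2) * 'I_K}|%:R :> R.
    by rewrite -natrM ler_nat card_U; nia.
  move: rate2; rewrite ler_pdivlMr //; lra.
have [s far] := paired_perturbation_bound cell_inj U0 delta0 delta1
  (fun x t => Pt x t.1 t.2) ndelta.
exists (\matrix_(i, j) perturbed cell delta s (i, j)).
  split => [|i j|]; first exact: rank_le.
    by rewrite mxE; apply: perturbed_ge0.
  rewrite pair_bigA /= -[RHS](sum_perturbed cell U0 delta s).
  by apply: eq_bigr => -[i j] _; rewrite mxE.
move: far; congr (_ <= _); apply: eq_big => [x|x _].
  have -> : delta / 32 = 1 / 128 * rate R n K d1 d2 by rewrite /delta; lra.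
  rewrite /l1norm pair_bigA; congr (_ <= _).
  by apply: eq_bigr => -[i j] _; rewrite !mxE.
by apply: eq_bigr => k _; rewrite mxE -surjective_pairing.
Qed.

Theorem theorem2 (R : realType) :
  exists c c' : R, [/\ 0 < c, 0 < c' &
    forall (n K d1 d2 : nat),
      (0 < n)%N -> (0 < K)%N -> (0 < d1)%N -> (0 < d2)%N ->
      (K <= minn d1 d2)%N -> (1 < maxn d1 d2)%N ->
    forall (dOmega : measure_display) (Omega : measurableType dOmega)
      (X : 'I_n -> Omega -> 'I_d1 * 'I_d2)
      (PP : 'M[R]_(d1, d2) -> probability Omega R),
      (forall P, low_rank_pmf K P -> iid_sample (PP P) X P) ->
      (c'%:E <= minimax (low_rank_pmf K) (fun (Pt : estimator R n d1 d2) P =>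
         PP P [set w | (c * rate R n K d1 d2
                          <= l1norm (Pt (observed X w) - P))%R]))%E /\
      ((c * rate R n K d1 d2)%:E
         <= minimax (low_rank_pmf K) (fun (Pt : estimator R n d1 d2) P =>
              'E_(PP P)[fun w => l1norm (Pt (observed X w) - P)]))%E].
Proof.
(* 1 / 2048 is 1 / 128 times 1 / 16, the factor lost to Markov's inequality. *)
exists (1 / 2048), (1 / 16); split; [lra | lra |].
move=> n K d1 d2 n0 K0 _ _ Kd d0 dOmega Omega X PP iid.
have r0 := @rate_gt0 R n K d1 d2 n0 K0 d0.
have hard (Pt : estimator R n d1 d2) : exists2 P, low_rank_pmf K P &
    ((1 / 16)%:E <= PP P [set w | (1 / 128 * rate R n K d1 d2
                                     <= l1norm (Pt (observed X w) - P))%R])%E.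
  have [P lrP far] := low_rank_hard_pmf Pt n0 K0 Kd d0; exists P => //.
  by rewrite (prob_observed (iid P lrP)
    (fun x => 1 / 128 * rate R n K d1 d2 <= l1norm (Pt x - P))) lee_fin.
split; apply: le_minimax => Pt; have [P lrP far] := hard Pt; exists P => //.
  apply: le_trans far _; apply: le_measure; rewrite ?inE.
  - exact: (measurable_observed (iid P lrP)
      [set x | 1 / 128 * rate R n K d1 d2 <= l1norm (Pt x - P)]).
  - exact: (measurable_observed (iid P lrP)
      [set x | 1 / 2048 * rate R n K d1 d2 <= l1norm (Pt x - P)]).
  by move=> w /=; apply: le_trans; rewrite ler_pM2r //; lra.
have l1_ge0 x : 0 <= l1norm (Pt x - P).
  by apply: sumr_ge0 => i _; apply: sumr_ge0.
have a0 : 0 < 1 / 128 * rate R n K d1 d2 by apply: mulr_gt0 => //; lra.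
apply: le_trans (markov_observed (iid P lrP) l1_ge0 a0).
apply: le_trans (lee_wpmul2l _ far); last by rewrite lee_fin ltW.
by rewrite -EFinM lee_fin; lra.
Qed.
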